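(* Let $p$ be an odd prime, let $K$ be an algebraically closed field of characteristic $p$, let $X$ be an indeterminate, and let $$A:=K\left[X,\ \frac{1}{\sqrt{(X+a)^3}+\sqrt{b^3}}\ ;\ a,b\in K,\ b\neq 0\right],$$ where one value of each square radical has been chosen. Then $A$ is a one-dimensional Noetherian domain that is not F-finite, such that the localization $A_{\mathfrak p}$ is F-finite for every prime ideal $\mathfrak p$ of $A$.
   Context: All rings are commutative and unitary. A ring $R$ of prime characteristic $p$ (i.e. containing a field of characteristic $p$) is called F-finite if its Frobenius morphism $F_R:R\to R$, $F_R(x)=x^p$, is a finite morphism, i.e. $R$ is a finitely generated $R$-module via $F_R$. Meaning of the radicals in the definition of $A$: fix an algebraic closure $\Omega$ of $K(X)$. For each $a\in K$, $\sqrt{(X+a)^3}$ denotes one fixed, arbitrarily chosen element of $\Omega$ whose square is $(X+a)^3$. For each nonzero $c\in K$, $\sqrt{c}$ denotes one fixed, arbitrarily chosen element of $K$ whose square is $c$; thus $\sqrt{b^3}$ depends only on the element $b^3$, and $\sqrt{a^3}+\sqrt{b^3}\neq 0$ for all nonzero $a,b\in K$. The ring $A$ is the $K$-subalgebra of $\Omega$ generated by $X$ and all the elements $\left(\sqrt{(X+a)^3}+\sqrt{b^3}\right)^{-1}$ with $a,b\in K$, $b\neq 0$, for these fixed choices. *)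

(* Defs.v *)
From HB Require Import structures.
From mathcomp Require Import all_boot all_order all_algebra.
From mathcomp Require Import boolp.
From mathcomp Require Import ring.

Set Implicit Arguments.
Unset Strict Implicit.
Unset Printing Implicit Defensive.

Import GRing.Theory.
Local Open Scope ring_scope.
Local Open Scope quotient_scope.

Section Finiteness.

Definition finite_morphism (R S : comNzRingType) (f : {rmorphism R -> S}) : Prop :=
  exists (n : nat) (g : 'I_n -> S), forall y : S,
    exists c : 'I_n -> R, y = \sum_(i < n) f (c i) * g i.

Definition F_finite (p : nat) (R : comNzRingType) (charRp : p \in [pchar R]) : Prop :=
  finite_morphism (pFrobenius_aut charRp).

(* [submod_closed] over the regular module [R^o] also allows the unit ideal,
   unlike [idealr_closed]. *)
Definition noetherian (R : comNzRingType) : Prop :=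
  forall I : {pred R}, submod_closed (I : {pred R^o}) ->
    exists (n : nat) (g : 'I_n -> R), forall x : R,
      x \in I <-> exists c : 'I_n -> R, x = \sum_(i < n) c i * g i.

(* Classically (see [asbool]) the boolean predicates in [prime_idealr R] are all
   the prime ideals of [R]; they are proper by definition. *)
Definition prime_chain (R : comNzRingType) (n : nat)
    (P : 'I_n.+1 -> prime_idealr R) : Prop :=
  forall i j : 'I_n.+1, (i < j)%N ->
    {subset P i <= P j} /\ ~ {subset P j <= P i}.

Definition has_krull_dim (R : comNzRingType) (d : nat) : Prop :=
  (exists P : 'I_d.+1 -> prime_idealr R, prime_chain P) /\
  (forall (n : nat) (P : 'I_n.+1 -> prime_idealr R), prime_chain P -> (n <= d)%N).

End Finiteness.

Section Localization.
Variables (R : comNzRingType) (P : prime_idealr R).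

Record pratio := PRatio { pfrac :> R * R; _ : pfrac.2 \notin P }.
HB.instance Definition _ := [isSub for pfrac].
HB.instance Definition _ := [Choice of pratio by <:].

Lemma pratioP (x : pratio) : x.2 \notin P. Proof. by case: x. Qed.

Lemma notin1 : 1 \notin P. Proof. by rewrite idealr1. Qed.

Lemma notinM (s t : R) : s \notin P -> t \notin P -> s * t \notin P.
Proof. by move=> hs ht; rewrite prime_idealrM negb_or hs. Qed.

(* The factor [u] is needed because [R] may have zero divisors. *)
Definition eqloc (x y : pratio) : bool :=
  `[< exists2 u : R, u \notin P & u * (x.1 * y.2 - y.1 * x.2) = 0 >].

Lemma eqloc_refl : reflexive eqloc.
Proof. by move=> x; apply/asboolP; exists 1; rewrite ?notin1 // subrr mulr0. Qed.

Lemma eqloc_sym : symmetric eqloc.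
Proof.
by move=> x y; apply/asboolP/asboolP => -[u hu e]; exists u => //;
  rewrite -opprB mulrN e oppr0.
Qed.

Lemma eqloc_trans : transitive eqloc.
Proof.
move=> y x z /asboolP[u hu e] /asboolP[v hv f]; apply/asboolP.
exists (u * v * y.2); first by rewrite !notinM ?pratioP.
have -> : u * v * y.2 * (x.1 * z.2 - z.1 * x.2) =
  v * z.2 * (u * (x.1 * y.2 - y.1 * x.2)) + u * x.2 * (v * (y.1 * z.2 - z.1 * y.2)). by ring.
by rewrite e f !mulr0 addr0.
Qed.

Canonical eqloc_equiv := EquivRel eqloc eqloc_refl eqloc_sym eqloc_trans.

Definition localization := {eq_quot eqloc}.
HB.instance Definition _ : EqQuotient _ eqloc localization :=
  EqQuotient.on localization.
HB.instance Definition _ := Choice.on localization.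

Lemma eqlocP (x y : pratio) :
  \pi_localization x = \pi_localization y <->
  exists2 u : R, u \notin P & u * (x.1 * y.2 - y.1 * x.2) = 0.
Proof.
split=> [/eqmodP/asboolP //|e]; apply/eqmodP; exact/asboolP.
Qed.

Definition addl (x y : pratio) : pratio :=
  @PRatio (x.1 * y.2 + y.1 * x.2, x.2 * y.2) (notinM (pratioP x) (pratioP y)).
Definition oppl (x : pratio) : pratio := @PRatio (- x.1, x.2) (pratioP x).
Definition mull (x y : pratio) : pratio :=
  @PRatio (x.1 * y.1, x.2 * y.2) (notinM (pratioP x) (pratioP y)).
Definition embl (a : R) : pratio := @PRatio (a, 1) notin1.

Definition loc_add := lift_op2 localization addl.
Definition loc_opp := lift_op1 localization oppl.
Definition loc_mul := lift_op2 localization mull.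
Definition to_loc : R -> localization := lift_embed localization embl.
Canonical to_loc_pi_morph := PiEmbed to_loc.

Lemma repr_loc (x : pratio) : exists2 u : R, u \notin P &
  u * (x.1 * (repr (\pi_localization x)).2) =
  u * ((repr (\pi_localization x)).1 * x.2).
Proof.
have /eqlocP[u hu /eqP] : \pi_localization x = \pi_localization (repr (\pi_localization x)).
  by rewrite reprK.
by rewrite mulrBr subr_eq0 => /eqP e; exists u.
Qed.

Lemma pi_loc_add : {morph \pi : x y / addl x y >-> loc_add x y}.
Proof.
move=> x y; unlock loc_add; apply/eqlocP => /=.
have [u hu e] := repr_loc x; have [v hv f] := repr_loc y.
move: (repr (\pi x)) (repr (\pi y)) e f => x' y' e f.
exists (u * v); first exact: notinM.
transitivity (v * y.2 * y'.2 * (u * (x.1 * x'.2) - u * (x'.1 * x.2))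
  + u * x.2 * x'.2 * (v * (y.1 * y'.2) - v * (y'.1 * y.2))); first by ring.
by rewrite e f !subrr !mulr0 addr0.
Qed.
Canonical pi_loc_add_morph := PiMorph2 pi_loc_add.

Lemma pi_loc_opp : {morph \pi : x / oppl x >-> loc_opp x}.
Proof.
move=> x; unlock loc_opp; apply/eqlocP => /=.
have [u hu e] := repr_loc x; move: (repr (\pi x)) e => x' e.
exists u => //; transitivity (- (u * (x.1 * x'.2) - u * (x'.1 * x.2))); first by ring.
by rewrite e subrr oppr0.
Qed.
Canonical pi_loc_opp_morph := PiMorph1 pi_loc_opp.

Lemma pi_loc_mul : {morph \pi : x y / mull x y >-> loc_mul x y}.
Proof.
move=> x y; unlock loc_mul; apply/eqlocP => /=.
have [u hu e] := repr_loc x; have [v hv f] := repr_loc y.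
move: (repr (\pi x)) (repr (\pi y)) e f => x' y' e f.
exists (u * v); first exact: notinM.
transitivity (v * (y.1 * y'.2) * (u * (x.1 * x'.2) - u * (x'.1 * x.2))
  + u * (x'.1 * x.2) * (v * (y.1 * y'.2) - v * (y'.1 * y.2))); first by ring.
by rewrite e f !subrr !mulr0 addr0.
Qed.
Canonical pi_loc_mul_morph := PiMorph2 pi_loc_mul.

Lemma eqloc_ring (x y : pratio) :
  x.1 * y.2 = y.1 * x.2 -> \pi_localization x = \pi_localization y.
Proof. by move=> e; apply/eqlocP; exists 1; rewrite ?notin1 // e subrr mulr0. Qed.

Lemma loc_addA : associative loc_add.
Proof.
elim/quotW=> x; elim/quotW=> y; elim/quotW=> z; rewrite !piE.
by apply: eqloc_ring => /=; ring.
Qed.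

Lemma loc_addC : commutative loc_add.
Proof.
by elim/quotW=> x; elim/quotW=> y; rewrite !piE; apply: eqloc_ring => /=; ring.
Qed.

Lemma loc_add0 : left_id (to_loc 0) loc_add.
Proof. by elim/quotW=> x; rewrite !piE; apply: eqloc_ring => /=; ring. Qed.

Lemma loc_addN : left_inverse (to_loc 0) loc_opp loc_add.
Proof. by elim/quotW=> x; rewrite !piE; apply: eqloc_ring => /=; ring. Qed.

HB.instance Definition _ := GRing.isZmodule.Build localization
  loc_addA loc_addC loc_add0 loc_addN.

Lemma loc_mulA : associative loc_mul.
Proof.
elim/quotW=> x; elim/quotW=> y; elim/quotW=> z; rewrite !piE.
by apply: eqloc_ring => /=; ring.
Qed.

Lemma loc_mulC : commutative loc_mul.
Proof.
by elim/quotW=> x; elim/quotW=> y; rewrite !piE; apply: eqloc_ring => /=; ring.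
Qed.

Lemma loc_mul1 : left_id (to_loc 1) loc_mul.
Proof. by elim/quotW=> x; rewrite !piE; apply: eqloc_ring => /=; ring. Qed.

Lemma loc_mulDl : left_distributive loc_mul loc_add.
Proof.
elim/quotW=> x; elim/quotW=> y; elim/quotW=> z; rewrite !piE.
by apply: eqloc_ring => /=; ring.
Qed.

Lemma loc_1neq0 : to_loc 1 != to_loc 0.
Proof.
rewrite !piE; apply/asboolP => -[u hu] /=.
by rewrite !mulr1 subr0 mulr1 => u0; move: hu; rewrite u0 rpred0.
Qed.

HB.instance Definition _ := GRing.Zmodule_isComNzRing.Build localization
  loc_mulA loc_mulC loc_mul1 loc_mulDl loc_1neq0.

Lemma to_loc_is_zmod_morphism : zmod_morphism to_loc.
Proof.
move=> a b; rewrite -[RHS]/(loc_add (to_loc a) (loc_opp (to_loc b))) !piE.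
by apply: eqloc_ring => /=; ring.
Qed.

Lemma to_loc_is_monoid_morphism : monoid_morphism to_loc.
Proof.
split=> // a b; rewrite -[RHS]/(loc_mul (to_loc a) (to_loc b)) !piE.
by apply: eqloc_ring => /=; ring.
Qed.

HB.instance Definition _ := GRing.isZmodMorphism.Build R localization to_loc
  to_loc_is_zmod_morphism.
HB.instance Definition _ := GRing.isMonoidMorphism.Build R localization to_loc
  to_loc_is_monoid_morphism.

Lemma pchar_localization (p : nat) :
  p \in [pchar R] -> p \in [pchar localization].
Proof. exact: (rmorph_pchar to_loc). Qed.

End Localization.

Section GeneratedSubalgebra.
Variables (K L : comNzRingType) (f : {rmorphism K -> L}) (G : L -> Prop).

(* Closure under opposites follows from that under the scalar -1. *)
Inductive in_subalg : L -> Prop :=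
| In_subalg_scalar (c : K) : in_subalg (f c)
| In_subalg_gen (x : L) : G x -> in_subalg x
| In_subalg_add (x y : L) : in_subalg x -> in_subalg y -> in_subalg (x + y)
| In_subalg_mul (x y : L) : in_subalg x -> in_subalg y -> in_subalg (x * y).

Definition subalg_pred : {pred L} := fun x => `[< in_subalg x >].

Lemma subalgP (x : L) : reflect (in_subalg x) (x \in subalg_pred).
Proof. exact: asboolP. Qed.

Lemma subalg_pred_closed : subring_closed subalg_pred.
Proof.
split=> [|x y /subalgP hx /subalgP hy|x y /subalgP hx /subalgP hy]; apply/subalgP.
- by rewrite -(rmorph1 f); apply: In_subalg_scalar.
- apply: In_subalg_add => //; rewrite -mulN1r -(rmorph1 f) -rmorphN.
  by apply: In_subalg_mul => //; apply: In_subalg_scalar.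
- exact: In_subalg_mul.
Qed.
HB.instance Definition _ := GRing.isSubringClosed.Build L subalg_pred
  subalg_pred_closed.

Record subalg := Subalg { subalg_val : L; _ : subalg_val \in subalg_pred }.
HB.instance Definition _ := [isSub for subalg_val].
HB.instance Definition _ := [Choice of subalg by <:].
HB.instance Definition _ := [SubChoice_isSubComNzRing of subalg by <:].

Lemma pchar_subalg (p : nat) : p \in [pchar K] -> p \in [pchar subalg].
Proof.
move=> /(rmorph_pchar f); rewrite !inE => /andP[-> /eqP e] /=.
by apply/eqP/val_inj; rewrite rmorph_nat rmorph0.
Qed.

End GeneratedSubalgebra.

Section RingA.
Variables (K Omega : fieldType) (iota : {rmorphism {fraction {poly K}} -> Omega}).

Definition const_emb : {rmorphism K -> Omega} :=
  iota \o (@tofrac {poly K}) \o polyC.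

(* [Omega] stands for an algebraic closure of K(X), embedded by [iota]; [r a] is
   the chosen square root of ('X + a)^3 in [Omega], and [s c] that of [c] in [K].
   The convention 0^-1 = 0 is harmless: a denominator [r a + const_emb _] cannot
   vanish, since its first term squares to a nonconstant polynomial. *)
Definition genA (r : K -> Omega) (s : K -> K) (x : Omega) : Prop :=
  x = iota (tofrac 'X) \/
  exists a b : K, b != 0 /\ x = (r a + const_emb (s (b ^+ 3)))^-1.

Definition ringA (r : K -> Omega) (s : K -> K) : comNzRingType :=
  subalg const_emb (genA r s).

End RingA.

(* Main.v *)
Require Import Defs.
From HB Require Import structures.
From mathcomp Require Import all_boot all_order all_algebra.
From mathcomp Require Import boolp ring.

Set Implicit Arguments.
Unset Strict Implicit.
Unset Printing Implicit Defensive.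

Import GRing.Theory.
Local Open Scope ring_scope.

(** Write [A] for the ring, [x] for the indeterminate and [r a] for the chosen
    square root of [(x + a)^3]; it lies in [A]. The elements [r a + s (b^3)] are
    units of [A], whereas the [r a - s (b^3)] need not be. Over the point [x = c]
    of the affine line this forces [r a] to take the value [s ((c + a)^3)], a choice
    of sign for every [a] other than [- c], so that exactly one prime of [A] lies
    over that point. There [A] is an increasing union of etale extensions of the
    cusp [r (- c)^2 = (x - c)^3] with unchanged residue field [K]; in particular [A]
    is spanned by [1] and [r (- c)] over [K] modulo [x - c] ([cusp_decomp]).

    Consequently [A] is finite-dimensional over [K] modulo any nonzero polynomial in
    [x]. As all elements of [A] are algebraic over [K(x)], a nonzero ideal
    contains such a polynomial, so [A] is Noetherian ([A_noetherian]), and its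
    nonzero primes are the maximal ideals [(x - c, r (- c))] ([A_krull_dim]).

    Those ideals are proper because [x - c] is not invertible ([XsubC_nonunit]).
    This is where the radicals must be known to be independent over [K(x)], so that
    evaluating them at arbitrarily chosen square roots is a well-defined ring
    morphism ([evalto0]); independence follows from a little Kummer theory
    ([tower_sqr]) and a parity argument on multiplicities ([r_notin_tower]).

    At a prime [P] all the radicals except at most one are etale, hence generated by
    [x] over the [p]-th powers, so [A_P] is finite over its [p]-th powers
    ([localization_F_finite]). Globally, finitely many generators over the [p]-th
    powers involve finitely many radicals, and are constant modulo [x - c] for
    almost all [c]. All [p]-th powers are constant modulo [x - c] as well, but
    [r (- c)] is not since the cusp is singular ([r_singular]); so [A] is not
    F-finite ([not_F_finite]). *)

(** * Towers of quadratic extensions *)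

Section QuadraticTower.
Variables (F L : fieldType) (f : {rmorphism F -> L}).
Variables (I : eqType) (d : I -> F) (r : I -> L).
Hypothesis r_sqr : forall i, r i ^+ 2 = f (d i).
Hypothesis two_neq0 : 2 != 0 :> L.

(** [tower l] is the subfield of [L] generated over [f F] by the [r i] with [i] in
    [l], built one square root at a time; the list may have repetitions. *)
Fixpoint tower (l : seq I) (y : L) : Prop :=
  if l is i :: l' then
    exists u v, [/\ tower l' u, tower l' v & y = u + v * r i]
  else exists g, y = f g.

Lemma tower_base l g : tower l (f g).
Proof.
elim: l g => [|i l IHl] g /=; first by exists g.
by exists (f g), (f 0); split=> //; rewrite rmorph0 mul0r addr0.
Qed.

Lemma tower_cons i l y : tower l y -> tower (i :: l) y.
Proof.
move=> ly; exists y, 0; split=> //; last by ring.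
by rewrite -(rmorph0 f); apply: tower_base.
Qed.

Lemma tower_gen i l : tower (i :: l) (r i).
Proof.
exists 0, 1; split; last by ring.
  by rewrite -(rmorph0 f); apply: tower_base.
by rewrite -(rmorph1 f); apply: tower_base.
Qed.

Lemma towerD l x y : tower l x -> tower l y -> tower l (x + y).
Proof.
elim: l x y => [|i l IHl] x y /=.
  by move=> [g ->] [h ->]; exists (g + h); rewrite rmorphD.
move=> [u [v [lu lv ->]]] [u' [v' [lu' lv' ->]]].
by exists (u + u'), (v + v'); split; [apply: IHl | apply: IHl | ring].
Qed.

Lemma towerM l x y : tower l x -> tower l y -> tower l (x * y).
Proof.
elim: l x y => [|i l IHl] x y /=.
  by move=> [g ->] [h ->]; exists (g * h); rewrite rmorphM.
move=> [u [v [lu lv ->]]] [u' [v' [lu' lv' ->]]].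
exists (u * u' + v * v' * f (d i)), (u * v' + v * u'); split.
- by apply: towerD; [apply: IHl | apply: (IHl); [apply: IHl|apply: tower_base]].
- by apply: towerD; apply: IHl.
- by rewrite -r_sqr; ring.
Qed.

Lemma towerN l x : tower l x -> tower l (- x).
Proof.
move=> lx; rewrite -mulN1r; apply: towerM => //.
by rewrite -(rmorph1 f) -rmorphN; apply: tower_base.
Qed.

Lemma towerV l x : tower l x -> tower l x^-1.
Proof.
elim: l x => [|i l IHl] x; first by move=> [g ->]; exists g^-1; rewrite fmorphV.
move=> [u [v [lu lv ->]]].
have [s0|s0] := eqVneq (u - v * r i) 0.
  have -> : u + v * r i = u + u by rewrite -(subr0_eq s0).
  by apply: tower_cons; apply: IHl; apply: towerD.
have [t0|t0] := eqVneq (u + v * r i) 0.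
  by rewrite t0 invr0 -(rmorph0 f); apply: tower_base.
have -> : (u + v * r i)^-1 = (u - v * r i) * (u ^+ 2 - v ^+ 2 * f (d i))^-1.
  have -> : u ^+ 2 - v ^+ 2 * f (d i) = (u + v * r i) * (u - v * r i).
    by rewrite -r_sqr; ring.
  by rewrite invfM mulrCA divff // mulr1.
apply: towerM.
  apply: towerD; first exact: tower_cons.
  by apply: towerN; apply: towerM; [apply: tower_cons | apply: tower_gen].
apply: tower_cons; apply: IHl; apply: towerD; first exact: towerM.
by apply: towerN; apply: towerM; [apply: towerM | apply: tower_base].
Qed.

(** The case of Kummer theory that is needed: an element of [F(r i, i in l)] whose
    square lies in [F] is an [F]-multiple of a product of the [r i]. No
    independence of the [r i] is assumed: in [(u + v r_i)^2 = e] the cross term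
    [2 u v r_i] either vanishes or puts [r_i] in the smaller field. *)
Lemma tower_sqr l y e : tower l y -> y ^+ 2 = f e ->
  exists g T, {subset T <= l} /\ y = f g * \prod_(i <- T) r i.
Proof.
elim: l y e => [|i l IHl] y e.
  by move=> [g ->] _; exists g, [::]; split=> //; rewrite big_nil mulr1.
have sub T : {subset T <= l} -> {subset T <= i :: l}.
  by move=> Tl j /Tl jl; rewrite inE jl orbT.
move=> [u [v [lu lv yE]]] y2.
have [v0|v0] := eqVneq v 0.
  have [|g [T [/sub Tl ->]]] := IHl y e _ y2; first by rewrite yE v0 mul0r addr0.
  by exists g, T.
have [u0|u0] := eqVneq u 0.
  have [i0|i0] := eqVneq (r i) 0.
    exists 0, [::]; split=> //; rewrite yE u0 i0 rmorph0; ring.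
  have [|g [T [Tl vE]]] := IHl v (e / d i) lv.
    by rewrite fmorph_div -y2 -r_sqr yE u0 add0r exprMn mulfK // expf_neq0.
  exists g, (i :: T); split; last by rewrite yE u0 vE big_cons; ring.
  by move=> j; rewrite !inE => /orP[->//|/Tl ->]; rewrite orbT.
have ri : tower l (r i).
  have -> : r i = (f e - u ^+ 2 - v ^+ 2 * f (d i)) / (2 * u * v).
    apply: canRL (mulfK _) _; first by rewrite !mulf_neq0.
    by rewrite -y2 -r_sqr yE; ring.
  apply: towerM; last apply: towerV.
    apply: towerD; last by apply: towerN; apply: towerM; [apply: towerM|apply: tower_base].
    by apply: towerD; [apply: tower_base | apply: towerN; apply: towerM].
  apply: towerM => //; apply: towerM => //.
  by rewrite -[2](rmorph_nat f 2); apply: tower_base.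
have [|g [T [/sub Tl ->]]] := IHl y e _ y2; last by exists g, T.
by rewrite yE; apply: towerD => //; apply: towerM.
Qed.
End QuadraticTower.

(** * Denominators and algebraic elements *)

Section Frac.
Variable R : idomainType.

Lemma fracE (x : {fraction R}) :
  exists n d : R, d != 0 /\ x * tofrac d = tofrac n.
Proof.
elim/quotW: x => x; exists (frac x).1, (frac x).2.
split; first exact: denom_ratioP.
rewrite -[X in X = _]/(FracField.mul _ _) !piE.
apply/eqmodP; rewrite /= FracField.equivfE /FracField.mulf.
rewrite !numden_Ratio ?mulf_neq0 ?oner_neq0 ?denom_ratioP //.
by rewrite !mulr1 mulrC.
Qed.

Lemma frac_polyE (P : {poly {fraction R}}) :
  exists d (Q : {poly R}), d != 0 /\ tofrac d *: P = map_poly (@tofrac R) Q.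
Proof.
elim/poly_ind: P => [|P c [d [Q [d0 dE]]]].
  by exists 1, 0; rewrite oner_neq0 scaler0 map_poly0.
have [n [m [m0 cE]]] := fracE c.
exists (d * m), (m *: Q * 'X + (d * n)%:P); split; first exact: mulf_neq0.
rewrite [RHS](rmorphD (map_poly (@tofrac R))) (rmorphM (map_poly (@tofrac R))) /=.
rewrite map_polyX map_polyC map_polyZ -dE /= !tofracM -cE.
by rewrite -!mul_polyC !polyCM; ring.
Qed.
End Frac.

(** A nonzero algebraic element [f] of a domain divides a nonzero element of the base
    ring, namely the constant coefficient of an equation of [f] not divisible by
    the variable. *)
Lemma root_dvd_coef (R A : comNzRingType) (ev : {rmorphism R -> A})
    (Q : {poly R}) (f : A) :
  GRing.integral_domain_axiom A -> Q != 0 -> f != 0 -> (map_poly ev Q).[f] = 0 ->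
  exists g q, q != 0 /\ f * g = ev q.
Proof.
move=> dom Q0 f0; elim/poly_ind: Q Q0 => [|Q c IH]; first by rewrite eqxx.
rewrite rmorphD rmorphM /= map_polyX map_polyC hornerMXaddC => Q0 e.
have [c0|c0] := eqVneq c 0; last first.
  exists (- (map_poly ev Q).[f]), c; split=> //.
  by rewrite mulrN mulrC; apply/eqP; rewrite eq_sym -addr_eq0 addrC e.
move: Q0 e; rewrite c0 polyC0 raddf0 !addr0 => Q0 e.
move: (dom _ _ e) => /orP[/eqP|]; last by rewrite (negPf f0).
by apply: IH; apply: contraNneq Q0 => ->; rewrite mul0r.
Qed.

(** * Evaluating the radicals at a point of the line *)

Section Values.
Variables (K : fieldType) (s : K -> K).
Hypothesis two_neq0 : 2 != 0 :> K.
Hypothesis s_sqrt : forall c : K, c != 0 -> s c ^+ 2 = c.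

(** The value taken at the point [X = c] by the radical [r a] in a prime of the
    ring over that point: since [r a + s (b ^+ 3)] is invertible for [b = c + a],
    it must be [s ((c + a) ^+ 3)] and not its opposite. At the branch point
    [c = - a] the value is zero; [s 0] is unconstrained, hence the case split. *)
Definition rval (c a : K) : K := if c + a == 0 then 0 else s ((c + a) ^+ 3).

Lemma rval_sqr c a : rval c a ^+ 2 = (c + a) ^+ 3.
Proof.
rewrite /rval; case: eqVneq => [->|ca0]; first by rewrite !expr0n.
by rewrite s_sqrt // expf_neq0.
Qed.

(** No inverted denominator vanishes at these values, because [s] never takes two
    opposite nonzero values. *)
Lemma rval_add_neq0 c a b : b != 0 -> rval c a + s (b ^+ 3) != 0.
Proof.
move=> b0; have b30 : b ^+ 3 != 0 by rewrite expf_neq0.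
have s0 : s (b ^+ 3) != 0.
  by apply: contra (b30) => /eqP s0; rewrite -(s_sqrt b30) s0 expr0n.
apply/negP => /eqP e; have {}e : rval c a = - s (b ^+ 3) by apply/eqP; rewrite -addr_eq0 e.
have cb : (c + a) ^+ 3 = b ^+ 3 by rewrite -rval_sqr e sqrrN s_sqrt.
move: e; rewrite /rval; case: eqVneq => [ca0 /esym/eqP|_].
  by rewrite oppr_eq0 (negPf s0).
rewrite cb => /eqP; rewrite -addr_eq0 -mulr2n -mulr_natl mulf_eq0.
by rewrite (negPf s0) (negPf two_neq0).
Qed.
End Values.

Section Radicals.
Variables (K Omega : fieldType) (iota : {rmorphism {fraction {poly K}} -> Omega}).
Variables (r : K -> Omega) (s : K -> K).
Hypothesis two_neq0 : 2 != 0 :> K.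
Hypothesis r_sqrt : forall a : K, r a ^+ 2 = iota (tofrac (('X + a%:P) ^+ 3)).
Hypothesis s_sqrt : forall c : K, c != 0 -> s c ^+ 2 = c.

Lemma Omega_two_neq0 : 2 != 0 :> Omega.
Proof.
by rewrite -(rmorph_nat (const_emb iota) 2) fmorph_eq0.
Qed.

(** The radicals are independent: otherwise [(X + a)^3] would be, up to a square,
    a product of cubes of other linear forms, and the multiplicity of [- a] would
    be both odd and even. *)
Lemma r_notin_tower (a : K) (l : seq K) : a \notin l -> ~ tower iota r l (r a).
Proof.
move=> al lra.
have [g [T [Tl raE]]] := tower_sqr r_sqrt Omega_two_neq0 lra (r_sqrt a).
have [n [m [m0 gm]]] := fracE g.
have XN (b : K) : 'X + b%:P = 'X - (- b)%:P by rewrite polyCN opprK.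
have X0 (b : K) : 'X + b%:P != 0 by rewrite XN polyXsubC_eq0.
have eq2 : m ^+ 2 * ('X + a%:P) ^+ 3 = n ^+ 2 * \prod_(i <- T) ('X + i%:P) ^+ 3.
  apply/eqP; rewrite -tofrac_eq; apply/eqP/(fmorph_inj iota).
  rewrite [in LHS]tofracM [in RHS]tofracM !(tofracXn 2) (rmorph_prod (@tofrac _)).
  rewrite -gm [LHS]rmorphM [RHS]rmorphM !(rmorphXn iota 2) (rmorph_prod iota) /=.
  rewrite -r_sqrt raE rmorphM -(eq_bigr _ (fun i _ => r_sqrt i)).
  by rewrite prodrXl; ring.
have n0 : n != 0.
  apply: contraTneq (_ : m ^+ 2 * ('X + a%:P) ^+ 3 != 0) => [n0|].
    by rewrite eq2 n0 expr0n mul0r eqxx.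
  by rewrite mulf_neq0 ?expf_neq0.
have aT : ~~ root (\prod_(i <- T) ('X + i%:P) ^+ 3) (- a).
  rewrite /root horner_prod prodf_seq_neq0; apply/allP => i iT /=.
  rewrite horner_exp expf_neq0 // XN hornerXsubC opprK addrC subr_eq0.
  by apply: contra al => /eqP <-; apply: Tl.
have /(congr1 odd) := congr1 (mup (- a)) eq2.
rewrite (mupMl _ aT) mupM ?expf_neq0 // XN mup_XsubCX eqxx.
by rewrite !expr2 !mupM // !addnn oddD !odd_double.
Qed.

Section Evaluation.
Variable c : K.

(** [evalto l x k]: [x] is a polynomial in ['X] and the [r a], [a] in [l], and [k]
    is its value under ['X := c], [r a := rval s c a]. For a list [l] without
    repetitions this is the graph of a ring morphism ([evalto0]), thanks to the
    independence of the radicals. *)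
Fixpoint evalto (l : seq K) (x : Omega) (k : K) : Prop :=
  if l is a :: l' then
    exists u v i j, [/\ evalto l' u i, evalto l' v j, x = u + v * r a
      & k = i + j * rval s c a]
  else exists q : {poly K}, x = iota (tofrac q) /\ k = q.[c].

Lemma evalto_poly l (q : {poly K}) : evalto l (iota (tofrac q)) q.[c].
Proof.
elim: l q => [|a l IHl] q /=; first by exists q.
exists (iota (tofrac q)), (iota (tofrac 0)), q.[c], 0.[c].
by split=> //; rewrite ?rmorph0 ?horner0 mul0r addr0.
Qed.

Lemma evalto_const l k : evalto l (const_emb iota k) k.
Proof. by have := evalto_poly l k%:P; rewrite hornerC. Qed.

Lemma evalto_cons a l x k : evalto l x k -> evalto (a :: l) x k.
Proof.
move=> lx; exists x, (const_emb iota 0), k, 0.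
split=> //; [exact: evalto_const | by rewrite rmorph0 mul0r addr0 | by ring].
Qed.

Lemma evalto_r l a : a \in l -> evalto l (r a) (rval s c a).
Proof.
elim: l => // b l IHl; rewrite inE => /predU1P[->|/IHl]; last exact: evalto_cons.
exists (const_emb iota 0), (const_emb iota 1), 0, 1.
by split; try exact: evalto_const; rewrite ?rmorph0 ?rmorph1; ring.
Qed.

Lemma evaltoD l x y i j : evalto l x i -> evalto l y j -> evalto l (x + y) (i + j).
Proof.
elim: l x y i j => [|a l IHl] x y i j /=.
  by move=> [p [-> ->]] [q [-> ->]]; exists (p + q); rewrite !rmorphD hornerD.
move=> [u [v [k [h [lu lv -> ->]]]]] [u' [v' [k' [h' [lu' lv' -> ->]]]]].
exists (u + u'), (v + v'), (k + k'), (h + h').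
by split; [apply: IHl | apply: IHl | ring | ring].
Qed.

Lemma evaltoM l x y i j : evalto l x i -> evalto l y j -> evalto l (x * y) (i * j).
Proof.
elim: l x y i j => [|a l IHl] x y i j /=.
  by move=> [p [-> ->]] [q [-> ->]]; exists (p * q); rewrite !rmorphM hornerM.
move=> [u [v [k [h [lu lv -> ->]]]]] [u' [v' [k' [h' [lu' lv' -> ->]]]]].
exists (u * u' + v * v' * iota (tofrac (('X + a%:P) ^+ 3))), (u * v' + v * u').
exists (k * k' + h * h' * (('X + a%:P) ^+ 3).[c]), (k * h' + h * k'); split.
- apply: evaltoD; first exact: (IHl).
  by apply: (IHl); [apply: (IHl) | apply: evalto_poly].
- by apply: evaltoD; apply: (IHl).
- by rewrite -r_sqrt; ring.
- by rewrite horner_exp hornerD hornerX hornerC -(rval_sqr s_sqrt); ring.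
Qed.

Lemma evalto_sub l l' x k : {subset l <= l'} -> evalto l x k -> evalto l' x k.
Proof.
elim: l x k => [|a l IHl] x k ll' /=.
  by move=> [q [-> ->]]; apply: evalto_poly.
have {}IHl y h : evalto l y h -> evalto l' y h.
  by apply: IHl => b bl; rewrite ll' // inE bl orbT.
move=> [u [v [i [j [/IHl lu /IHl lv -> ->]]]]].
by apply: evaltoD => //; apply: evaltoM => //; apply: evalto_r; rewrite ll' ?mem_head.
Qed.

Lemma evalto_tower l x k : evalto l x k -> tower iota r l x.
Proof.
elim: l x k => [|a l IHl] x k /=; first by move=> [q [-> _]]; exists (tofrac q).
by move=> [u [v [i [j [/IHl lu /IHl lv -> _]]]]]; exists u, v.
Qed.

Lemma evalto0 l k : uniq l -> evalto l 0 k -> k = 0.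
Proof.
elim: l k => [|a l IHl] k /=.
  move=> _ [q [/esym/eqP]]; rewrite fmorph_eq0 tofrac_eq0 => /eqP -> ->.
  by rewrite horner0.
move=> /andP[al ul] [u [v [i [j [lu lv /esym e ->]]]]].
have [v0|v0] := eqVneq v 0.
  rewrite v0 mul0r addr0 in e; rewrite v0 in lv; rewrite e in lu.
  by rewrite (IHl i) // (IHl j) //; ring.
case: (@r_notin_tower a l al).
have -> : r a = - u * v^-1.
  by apply: canRL (mulfK _) _ => //; apply/eqP; rewrite -addr_eq0 -e; apply/eqP; ring.
apply: (towerM r_sqrt); first exact: (towerN r_sqrt (evalto_tower lu)).
exact: (towerV r_sqrt (evalto_tower lv)).
Qed.

Lemma evalto_denom a b : evalto [:: a] (r a + const_emb iota (s (b ^+ 3)))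
  (rval s c a + s (b ^+ 3)).
Proof. by apply: evaltoD; [apply: evalto_r; rewrite mem_head | apply: evalto_const]. Qed.

Lemma denom_neq0 a b : b != 0 -> r a + const_emb iota (s (b ^+ 3)) != 0.
Proof.
move/(rval_add_neq0 two_neq0 s_sqrt c a) => j0; apply: contra (j0) => /eqP d0.
by have := evalto_denom a b; rewrite d0 => /evalto0 ->.
Qed.

(** Every element of the ring is a fraction whose denominator has a nonzero value
    at [c]. *)
Lemma evalto_subalg f : in_subalg (const_emb iota) (genA iota r s) f ->
  exists l n d i j, [/\ evalto l n i, evalto l d j, j != 0 & f * d = n].
Proof.
elim=> {f} [k|x [->|[a [b [b0 ->]]]]|x y _ [l [n [d [i [j [ln ld j0 e]]]]]] _
  [l' [n' [d' [i' [j' [ln' ld' j0' e']]]]]]|x y _ [l [n [d [i [j [ln ld j0 e]]]]]] _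
  [l' [n' [d' [i' [j' [ln' ld' j0' e']]]]]]].
- exists [::], (const_emb iota k), (const_emb iota 1), k, 1.
  by split; try exact: evalto_const; rewrite ?oner_neq0 ?rmorph1 ?mulr1.
- exists [::], (iota (tofrac 'X)), (const_emb iota 1), 'X.[c], 1.
  by split; [apply: evalto_poly|apply: evalto_const|apply: oner_neq0|rewrite rmorph1 mulr1].
- exists [:: a], (const_emb iota 1), (r a + const_emb iota (s (b ^+ 3))), 1.
  exists (rval s c a + s (b ^+ 3)).
  split; [exact: evalto_const | exact: evalto_denom | exact: rval_add_neq0 |].
  by rewrite rmorph1 mulVf // denom_neq0.
- have s1 : {subset l <= l ++ l'} by move=> z zl; rewrite mem_cat zl.
  have s2 : {subset l' <= l ++ l'} by move=> z zl; rewrite mem_cat zl orbT.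
  exists (l ++ l'), (n * d' + n' * d), (d * d'), (i * j' + i' * j), (j * j').
  move: (evalto_sub s1 ln) (evalto_sub s1 ld) (evalto_sub s2 ln') (evalto_sub s2 ld') => ? ? ? ?.
  split; [by apply: evaltoD; apply: evaltoM|exact: evaltoM|exact: mulf_neq0|].
  by rewrite -e -e'; ring.
- have s1 : {subset l <= l ++ l'} by move=> z zl; rewrite mem_cat zl.
  have s2 : {subset l' <= l ++ l'} by move=> z zl; rewrite mem_cat zl orbT.
  exists (l ++ l'), (n * n'), (d * d'), (i * i'), (j * j').
  move: (evalto_sub s1 ln) (evalto_sub s1 ld) (evalto_sub s2 ln') (evalto_sub s2 ld') => ? ? ? ?.
  split; [exact: evaltoM|exact: evaltoM|exact: mulf_neq0|].
  by rewrite -e -e'; ring.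
Qed.

(** Hence there is a prime over each point [c] of the line. *)
Lemma XsubC_nonunit f : in_subalg (const_emb iota) (genA iota r s) f ->
  iota (tofrac ('X - c%:P)) * f <> 1.
Proof.
move=> /evalto_subalg[l [n [d [i [j [ln ld j0 e]]]]]] f1.
have dE : d = iota (tofrac ('X - c%:P)) * n by rewrite -e mulrA f1 mul1r.
move/negP: j0; apply.
have sl : {subset l <= undup l} by move=> z; rewrite mem_undup.
have eX := evaltoM (evalto_poly (undup l) ('X - c%:P)) (evalto_sub sl ln).
have e1 := evaltoM (evalto_const (undup l) (- 1)) (evalto_sub sl ld).
have := evaltoD eX e1; rewrite dE rmorphN rmorph1 mulN1r subrr.
rewrite hornerXsubC subrr mul0r add0r mulN1r => /(evalto0 (undup_uniq l)) /eqP.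
by rewrite oppr_eq0.
Qed.

End Evaluation.
End Radicals.

(** * Rings generated by two elements over their p-th powers *)

Section FrobeniusSpan.
Variables (p : nat) (B : comNzRingType) (charBp : p \in [pchar B]) (u v : B).

(** The subring [B^p[u, v]], as the additive span of the [a^p u^i v^j]. *)
Inductive frob_span : B -> Prop :=
| Frob_span0 : frob_span 0
| Frob_spanD (a : B) (i j : nat) (y : B) :
    frob_span y -> frob_span (a ^+ p * u ^+ i * v ^+ j + y).

Lemma frob_span_add y z : frob_span y -> frob_span z -> frob_span (y + z).
Proof.
move=> sy sz; elim: sy => [|a i j {}y _ IH]; first by rewrite add0r.
by rewrite -addrA; apply: Frob_spanD.
Qed.

Lemma frob_span_monom a i j : frob_span (a ^+ p * u ^+ i * v ^+ j).
Proof. by rewrite -[_ * _]addr0; apply/Frob_spanD/Frob_span0. Qed.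

Lemma frob_span_mul y z : frob_span y -> frob_span z -> frob_span (y * z).
Proof.
move=> sy sz; elim: sy => [|a i j {}y _ IH]; first by rewrite mul0r; apply: Frob_span0.
rewrite mulrDl; apply: frob_span_add => //.
elim: sz => [|b k l {IH}z _ IH]; first by rewrite mulr0; apply: Frob_span0.
rewrite mulrDr; apply: frob_span_add => //.
have -> : a ^+ p * u ^+ i * v ^+ j * (b ^+ p * u ^+ k * v ^+ l) =
    (a * b) ^+ p * u ^+ (i + k) * v ^+ (j + l).
  by rewrite exprMn !exprD; ring.
exact: frob_span_monom.
Qed.

Lemma frob_span_pow a : frob_span (a ^+ p).
Proof. by have := frob_span_monom a 0 0; rewrite !mulr1. Qed.

Lemma frob_span_u : frob_span u.
Proof. by have := frob_span_monom 1 1 0; rewrite expr1n mul1r mulr1. Qed.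

Lemma frob_span_v : frob_span v.
Proof. by have := frob_span_monom 1 0 1; rewrite expr1n !mul1r. Qed.

Lemma frob_span_exp y n : frob_span y -> frob_span (y ^+ n).
Proof.
move=> sy; elim: n => [|n IH]; last by rewrite exprS; apply: frob_span_mul.
by have := frob_span_pow 1; rewrite expr1n.
Qed.

(** A subring containing all [p]-th powers is closed under inverses, since
    [y^-1 = (y^-1)^p y^(p-1)]. *)
Lemma frob_span_inv y w : frob_span y -> y * w = 1 -> frob_span w.
Proof.
move=> sy yw; have p0 := prime_gt0 (pcharf_prime charBp).
have -> : w = w ^+ p * y ^+ p.-1.
  by rewrite -(prednK p0) exprS /= -mulrA -exprMn mulrC [w * y]mulrC yw expr1n mul1r.
by apply: frob_span_mul; [apply: frob_span_pow | apply: frob_span_exp].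
Qed.

Lemma F_finite_frob_span : (forall y, frob_span y) -> F_finite charBp.
Proof.
move=> span; have p0 := prime_gt0 (pcharf_prime charBp).
exists (p * p)%N, (fun k => u ^+ (k %% p) * v ^+ (k %/ p)) => y.
elim: (span y) => [|a i j {}y _ [c yE]].
  exists (fun _ => 0); rewrite big1 // => k _.
  by rewrite rmorph0 mul0r.
(* The generator [u^i v^j], with [i, j < p], has index [i + j p]. *)
have k0P : ((i %% p) + (j %% p) * p < p * p)%N.
  by rewrite -ltn_divLR // divnDMl // divn_small ?ltn_mod // ltn_mod.
pose k0 := Ordinal k0P.
pose a' := a * u ^+ (i %/ p) * v ^+ (j %/ p).
exists (fun k => c k + (if k == k0 then a' else 0)).
under eq_bigr do rewrite rmorphD mulrDl.
rewrite big_split /= -yE addrC; congr (_ + _).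
rewrite (bigD1 k0) //= eqxx big1 => [|k /negPf ->]; last by rewrite rmorph0 mul0r.
rewrite addr0 pFrobenius_autE /a' !exprMn -!exprM.
have -> : ((i %% p + j %% p * p) %% p = i %% p)%N by rewrite addnC modnMDl modn_mod.
have -> : ((i %% p + j %% p * p) %/ p = j %% p)%N.
  by rewrite divnDMl // divn_small ?ltn_mod.
rewrite {1}(divn_eq i p) {1}(divn_eq j p) !exprD; ring.
Qed.
End FrobeniusSpan.

(** * Fractions in a localization *)

Section LocalizationTheory.
Local Open Scope quotient_scope.
Variables (R : comNzRingType) (P : prime_idealr R).

Lemma loc_frac (y : localization P) :
  exists a t, t \notin P /\ y * to_loc P t = to_loc P a.
Proof.
elim/quotW: y => y; exists y.1, y.2; split; first exact: pratioP.
rewrite -[LHS]/(loc_mul _ _) !piE.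
by apply: eqloc_ring => /=; ring.
Qed.

Lemma loc_inv (t : R) : t \notin P -> exists w, to_loc P t * w = 1.
Proof.
move=> tP; exists (\pi_(localization P) (@PRatio _ P (1, t) tP)).
rewrite -[LHS]/(loc_mul _ _) -[RHS]/(to_loc P 1) !piE.
by apply: eqloc_ring => /=; ring.
Qed.
End LocalizationTheory.

(** * Ideals *)

Section IdealGeneration.
Variable R : comNzRingType.

(** [f] is in the ideal generated by the list [gs]. *)
Fixpoint in_ideal_gen (gs : seq R) (f : R) : Prop :=
  if gs is g :: gs' then exists a h, in_ideal_gen gs' h /\ f = a * g + h
  else f = 0.

Lemma in_ideal_genP gs f : in_ideal_gen gs f ->
  exists a : 'I_(size gs) -> R, f = \sum_(i < size gs) a i * gs`_i.
Proof.
elim: gs f => [|g gs IH] f /=; first by move=> ->; exists (fun=> 0); rewrite big_ord0.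
move=> [a [h [/IH[b ->] ->]]].
exists (fun i => oapp b a (unlift ord0 i)).
rewrite big_ord_recl unlift_none /=; congr (_ + _).
by apply: eq_bigr => i _; rewrite liftK.
Qed.

Lemma ideal_fg (I : {pred R}) (gs : seq R) :
  submod_closed (I : {pred R^o}) -> {subset gs <= I} ->
  (forall f, f \in I -> in_ideal_gen gs f) ->
  exists (n : nat) (g : 'I_n -> R), forall f : R,
    f \in I <-> exists a : 'I_n -> R, f = \sum_(i < n) a i * g i.
Proof.
move=> [I0 Il] gsI Igs; exists (size gs), (fun i => gs`_i) => f.
split=> [/Igs/in_ideal_genP //|[a ->]].
elim/big_rec: _ => // i y _ yI.
by apply: (Il (a i) (gs`_i) y) => //; apply/gsI/mem_nth.
Qed.

(** A prime ideal from a predicate with the closure properties of one. *)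
Definition prime_of_pred (S : {pred R}) (S_ideal : idealr_closed S)
    (S_prime : prime_idealr_closed S) : prime_idealr R :=
  HB.pack S (isIdealr.Build R S S_ideal) (isPrimeIdealrClosed.Build R S S_prime).

End IdealGeneration.

(** * A ring with one cusp over each point of the line *)

(** The argument only uses the following about the ring: it is a domain containing
    square roots [r a] of the [(x + cst a) ^+ 3], it is generated over [K] by [x] and
    the inverses of the [r a + cst (s (b ^+ 3))], every nonzero element divides a
    nonzero polynomial in [x], and no [x - cst c] is invertible. *)

Section CuspidalRing.
Variables (K : closedFieldType) (A : comNzRingType) (cst : {rmorphism K -> A}).
Variables (x : A) (r : K -> A) (s : K -> K).
Hypothesis two_neq0 : 2 != 0 :> K.
Hypothesis s_sqrt : forall c : K, c != 0 -> s c ^+ 2 = c.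
Hypothesis A_domain : GRing.integral_domain_axiom A.
Hypothesis r_sqr : forall a, r a ^+ 2 = (x + cst a) ^+ 3.
Hypothesis denom_inv : forall a b, b != 0 ->
  exists w, (r a + cst (s (b ^+ 3))) * w = 1.
Hypothesis A_ind : forall Q : A -> Prop,
  (forall k, Q (cst k)) -> Q x ->
  (forall a b w, b != 0 -> (r a + cst (s (b ^+ 3))) * w = 1 -> Q w) ->
  (forall f g, Q f -> Q g -> Q (f + g)) ->
  (forall f g, Q f -> Q g -> Q (f * g)) ->
  forall f, Q f.
Hypothesis dvd_poly : forall f, f != 0 ->
  exists g (q : {poly K}), q != 0 /\ f * g = (map_poly cst q).[x].
Hypothesis x_sub_nonunit : forall c f, (x - cst c) * f <> 1.

Lemma mulfA_eq0 (f g : A) : f * g = 0 -> f = 0 \/ g = 0.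
Proof. by move/A_domain/orP => [/eqP|/eqP]; [left|right]. Qed.

Lemma cst_unit k : k != 0 -> cst k * cst k^-1 = 1.
Proof. by move=> k0; rewrite -rmorphM divff // rmorph1. Qed.

Lemma x_sub_dvd_cst c k f : cst k = (x - cst c) * f -> k = 0.
Proof.
have [->//|/cst_unit ku] := eqVneq k 0; move=> e.
by case: (@x_sub_nonunit c (f * cst k^-1)); rewrite mulrA -e.
Qed.

Lemma r_cusp c : r (- c) ^+ 2 = (x - cst c) ^+ 3.
Proof. by rewrite r_sqr rmorphN. Qed.

(** Away from the branch point, [r a] is congruent to a constant modulo [x - c],
    because [r a + cst (rval s c a)] is one of the units of the ring. *)
Lemma r_etale c a : c + a != 0 ->
  exists g, r a = cst (rval s c a) + (x - cst c) * g.
Proof.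
move=> ca0; have [w] := denom_inv a ca0.
have -> : s ((c + a) ^+ 3) = rval s c a by rewrite /rval (negPf ca0).
set k := rval s c a => wE.
have k2 : cst k ^+ 2 = (cst c + cst a) ^+ 3.
  by rewrite -rmorphXn /k (rval_sqr s_sqrt) rmorphXn rmorphD.
pose h := (x + cst a) ^+ 2 + (x + cst a) * (cst c + cst a) + (cst c + cst a) ^+ 2.
exists (h * w).
have e : (r a - cst k) * (r a + cst k) = (x - cst c) * h.
  transitivity (r a ^+ 2 - cst k ^+ 2); first by ring.
  by rewrite r_sqr k2 /h; ring.
by rewrite mulrA -e -mulrA wE; ring.
Qed.

(** [f] belongs to [K + (x - c) A]. *)
Definition const_mod (c : K) (f : A) : Prop := exists k g, f = cst k + (x - cst c) * g.

Lemma const_mod_cst c k : const_mod c (cst k).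
Proof. by exists k, 0; rewrite mulr0 addr0. Qed.

Lemma const_mod_x c : const_mod c x.
Proof. by exists c, 1; ring. Qed.

Lemma const_modD c f g : const_mod c f -> const_mod c g -> const_mod c (f + g).
Proof.
move=> [k [f' ->]] [l [g' ->]]; exists (k + l), (f' + g').
by rewrite rmorphD; ring.
Qed.

Lemma const_modM c f g : const_mod c f -> const_mod c g -> const_mod c (f * g).
Proof.
move=> [k [f' ->]] [l [g' ->]].
exists (k * l), (cst k * g' + f' * cst l + f' * (x - cst c) * g').
by rewrite rmorphM; ring.
Qed.

Lemma const_mod_denom c a b w : b != 0 -> c + a != 0 ->
  (r a + cst (s (b ^+ 3))) * w = 1 -> const_mod c w.
Proof.
move=> b0 /r_etale[h rE] wE.
have k0 := rval_add_neq0 two_neq0 s_sqrt c a b0.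
set k := rval s c a in rE k0; set l := s _ in wE k0.
exists (k + l)^-1, (- cst (k + l)^-1 * h * w).
transitivity (cst (k + l)^-1 * (cst (k + l) * w)).
  by rewrite mulrA [_ * cst _]mulrC cst_unit // mul1r.
have -> : cst (k + l) * w = 1 - (x - cst c) * h * w.
  by rewrite -wE rE rmorphD; ring.
by ring.
Qed.

(** Only finitely many radicals occur in [f], and [r a] is constant modulo [x - c]
    unless [c = - a]. *)
Lemma const_mod_cofinite f :
  exists T : seq K, forall c, - c \notin T -> const_mod c f.
Proof.
elim/A_ind: f => [k||a b w b0 wE|f g [T fT] [T' gT']|f g [T fT] [T' gT']].
- by exists [::] => c _; apply: const_mod_cst.
- by exists [::] => c _; apply: const_mod_x.
- exists [:: a] => c; rewrite inE eq_sym -addr_eq0 addrC => ca0.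
  exact: const_mod_denom wE.
- exists (T ++ T') => c; rewrite mem_cat negb_or => /andP[/fT ? /gT' ?].
  exact: const_modD.
- exists (T ++ T') => c; rewrite mem_cat negb_or => /andP[/fT ? /gT' ?].
  exact: const_modM.
Qed.

(** The fibre [A / (x - c)] is spanned over [K] by [1] and [r (- c)]. *)
Lemma cusp_decomp c f :
  exists k l g, f = cst k + cst l * r (- c) + (x - cst c) * g.
Proof.
have r2 := r_cusp c.
have of_const_mod g : const_mod c g ->
    exists k l h, g = cst k + cst l * r (- c) + (x - cst c) * h.
  by move=> [k [h ->]]; exists k, 0, h; rewrite rmorph0; ring.
elim/A_ind: f => [k||a b w b0 wE|f f' [k [l [g ->]]] [k' [l' [g' ->]]]
  |f f' [k [l [g ->]]] [k' [l' [g' ->]]]].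
- exact/of_const_mod/const_mod_cst.
- exact/of_const_mod/const_mod_x.
- have [ca0|ca0] := eqVneq (c + a) 0; last exact/of_const_mod/(const_mod_denom b0 ca0).
  have aE : a = - c by apply/eqP; rewrite -addr_eq0 addrC ca0.
  rewrite aE in wE; set m := s _ in wE.
  have m0 : m != 0.
    by have := rval_add_neq0 two_neq0 s_sqrt c a b0; rewrite /rval ca0 eqxx add0r.
  pose n := m^-1.
  have mn : cst m * cst n = 1 by apply: cst_unit.
  (* With [n = 1 / m]: w = n - n^2 r + n^2 r^2 w, and [r^2] is [(x - c)^3]. *)
  exists n, (- n ^+ 2), ((x - cst c) ^+ 2 * cst n ^+ 2 * w).
  transitivity ((cst m * cst n) ^+ 2 * w); first by rewrite mn expr1n mul1r.
  transitivity (cst n ^+ 2 * ((cst m - r (- c)) * ((r (- c) + cst m) * w) + r (- c) ^+ 2 * w)).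
    by ring.
  have nE : cst n = cst m * cst n ^+ 2 by rewrite expr2 mulrA mn mul1r.
  by rewrite wE r2 rmorphN rmorphXn [X in _ = X + _ + _]nE; ring.
- exists (k + k'), (l + l'), (g + g'); rewrite !rmorphD; ring.
- exists (k * k'), (k * l' + l * k').
  exists (cst k * g' + cst k' * g + cst l * r (- c) * g' + cst l' * r (- c) * g
    + (x - cst c) * g * g' + cst l * cst l' * (x - cst c) ^+ 2).
  rewrite !rmorphD !rmorphM.
  transitivity (cst k * cst k' + (cst k * cst l' + cst l * cst k') * r (- c) +
    (x - cst c) * (cst k * g' + cst k' * g + cst l * r (- c) * g' + cst l' * r (- c) * g
    + (x - cst c) * g * g') + cst l * cst l' * r (- c) ^+ 2); first by ring.
  by rewrite r2; ring.
Qed.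

(** The ideal [(x - c, r (- c))] is proper: [r (- c)] is nilpotent modulo
    [x - c]. *)
Lemma cusp_proper c g h : (x - cst c) * g + r (- c) * h <> 1.
Proof.
move=> e; pose e' := x - cst c.
apply: (@x_sub_nonunit c (2 * g - e' * g ^+ 2 + e' ^+ 2 * h ^+ 2)).
have rh : r (- c) * h = 1 - (x - cst c) * g by rewrite -e; ring.
transitivity (1 - (1 - (x - cst c) * g) ^+ 2 + (x - cst c) ^+ 3 * h ^+ 2).
  by rewrite /e'; ring.
by rewrite -rh -r_cusp; ring.
Qed.

Lemma x_sub_neq0 c : x - cst c != 0.
Proof.
apply/eqP => e; apply: (@x_sub_nonunit (c - 1) 1).
transitivity (x - cst c + 1); last by rewrite e add0r.
by rewrite rmorphB rmorph1; ring.
Qed.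

(** The point over [c] is singular. If [r (- c) = k + (x - c) f], then [k = 0] and
    [f] is a square root of [x - c]; writing [f = i + j r (- c) + (x - c) g] and
    squaring once more puts [1] in [(x - c, r (- c))]. *)
Lemma r_singular c : ~ const_mod c (r (- c)).
Proof.
pose e := x - cst c.
move=> [k [f rE]].
have k0 : k = 0.
  have : cst (k ^+ 2) = e * (e ^+ 2 - 2 * cst k * f - e * f ^+ 2).
    rewrite rmorphXn; transitivity (e ^+ 3 - (cst k + e * f) ^+ 2 + cst k ^+ 2).
      by rewrite -r_cusp rE /e; ring.
    by ring.
  by move/x_sub_dvd_cst/eqP; rewrite expf_eq0 => /eqP.
rewrite k0 rmorph0 add0r -/e in rE.
have e0 := x_sub_neq0 c.
have f2 : f ^+ 2 = e.
  have : e * (e * (f ^+ 2 - e)) = 0.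
    transitivity ((e * f) ^+ 2 - e ^+ 3); first by ring.
    by rewrite -rE r_cusp subrr.
  case/mulfA_eq0=> [/eqP|]; first by rewrite (negPf e0).
  case/mulfA_eq0=> [/eqP|/subr0_eq //]; first by rewrite (negPf e0).
have [i [j [g fE]]] := cusp_decomp c f.
have i0 : i = 0.
  have : cst (i ^+ 2) = e * (1 - 2 * f * (cst j * f + g) + e * (cst j * f + g) ^+ 2).
    rewrite rmorphXn.
    have -> : cst i = f - e * (cst j * f + g) by rewrite {1}fE rE /e; ring.
    by transitivity (f ^+ 2 - e * (2 * f * (cst j * f + g) -
      e * (cst j * f + g) ^+ 2)); [ring | rewrite f2; ring].
  by move/x_sub_dvd_cst/eqP; rewrite expf_eq0 => /eqP.
rewrite i0 rmorph0 add0r -/e in fE.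
apply: (@cusp_proper c (cst j ^+ 2 * e + g ^+ 2) (2 * cst j * g)).
suff : e * (e * (cst j ^+ 2 * e + g ^+ 2) + r (- c) * (2 * cst j * g) - 1) = 0.
  case/mulfA_eq0=> [/eqP|/subr0_eq //]; first by rewrite (negPf e0).
transitivity ((cst j * r (- c) + e * g) ^+ 2 - e - cst j ^+ 2 * (r (- c) ^+ 2 - e ^+ 3)
  - cst j ^+ 2 * (e ^+ 3 - e ^+ 2 * e)).
  by ring.
by rewrite -fE f2 r_cusp -/e; ring.
Qed.

(** All [p]-th powers lie in [K + (x - c) A]. So do, for all but finitely many [c],
    the members of a finite set of generators over the subring of [p]-th powers;
    but [r (- c)] never does. *)
Lemma not_F_finite p (charAp : p \in [pchar A]) : (2 < p)%N -> ~ F_finite charAp.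
Proof.
move=> p_gt2 [n [g gen]].
have [T gT] := fin_all_exists (fun i => const_mod_cofinite (g i)).
pose q := \prod_(a <- flatten [seq T i | i <- enum 'I_n]) ('X - a%:P).
have /closed_nonrootP[c'] : q != 0 by rewrite monic_neq0 // monic_prod_XsubC.
rewrite root_prod_XsubC -[c']opprK; set c := - c' => cT.
have pow f : const_mod c (f ^+ p).
  have [k [l [h ->]]] := cusp_decomp c f.
  rewrite -(pFrobenius_autE charAp) !rmorphD !rmorphM /= !pFrobenius_autE -!rmorphXn.
  apply: const_modD.
    apply: const_modD; first exact: const_mod_cst.
    apply: const_modM; first exact: const_mod_cst.
    exists 0, ((x - cst c) ^+ 2 * r (- c) ^+ (p - 2)).
    by rewrite -(subnKC (ltnW p_gt2)) exprD r_cusp rmorph0 addKn; ring.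
  exists 0, ((x - cst c) ^+ p.-1 * h ^+ p); rewrite rmorph0 add0r mulrA -exprS.
  by rewrite prednK // (ltn_trans _ p_gt2).
apply: (@r_singular c); have [a ->] := gen (r (- c)).
elim/big_rec: _ => [|i y _ yN]; first by rewrite -(rmorph0 cst); apply: const_mod_cst.
apply: const_modD yN; apply: const_modM; first exact: pow.
apply: gT; apply: contra cT => ciT; apply/flattenP; exists (T i) => //.
by apply: map_f; rewrite mem_enum.
Qed.

(** [f] is in the [K]-span of the list [vs]. *)
Fixpoint in_span (vs : seq A) (f : A) : Prop :=
  if vs is v :: vs' then exists k g, in_span vs' g /\ f = cst k * v + g
  else f = 0.

Lemma in_span_lin vs k f g : in_span vs f -> in_span vs g -> in_span vs (cst k * f + g).
Proof.
elim: vs f g => [|v vs IH] f g /=; first by move=> -> ->; rewrite mulr0 addr0.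
move=> [l [f' [sf' ->]]] [l' [g' [sg' ->]]].
exists (k * l + l'), (cst k * f' + g'); split; first exact: IH.
by rewrite rmorphD rmorphM; ring.
Qed.

Lemma in_span_map m vs f : in_span vs f -> in_span [seq m * v | v <- vs] (m * f).
Proof.
elim: vs f => [|v vs IH] f /=; first by move=> ->; rewrite mulr0.
move=> [k [g [sg ->]]]; exists k, (m * g); split; first exact: IH.
by ring.
Qed.

(** The quotient of [A] by a nonzero polynomial in [x] is finite-dimensional. *)
Lemma span_mod_prod (cs : seq K) :
  exists vs, forall f, exists g h, in_span vs g /\ f = g + \prod_(c <- cs) (x - cst c) * h.
Proof.
elim: cs => [|c cs [vs IH]].
  by exists [::] => f; exists 0, f; split=> //; rewrite big_nil mul1r add0r.
exists (1 :: r (- c) :: [seq (x - cst c) * v | v <- vs]) => f.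
have [k [l [f' ->]]] := cusp_decomp c f.
have [g [h [sg ->]]] := IH f'.
exists (cst k * 1 + (cst l * r (- c) + (x - cst c) * g)), h; split.
  exists k, (cst l * r (- c) + (x - cst c) * g); split=> //.
  by exists l, ((x - cst c) * g); split=> //; apply: in_span_map.
by rewrite big_cons; ring.
Qed.

Lemma map_poly_x_split (q : {poly K}) : q != 0 ->
  exists k cs, k != 0 /\ (map_poly cst q).[x] = cst k * \prod_(c <- cs) (x - cst c).
Proof.
move=> q0; have [cs qE] := closed_field_poly_normal q.
exists (lead_coef q), cs; split; first by rewrite lead_coef_eq0.
rewrite {1}qE map_polyZ hornerZ rmorph_prod horner_prod; congr (_ * _).
by apply: eq_bigr => c _; rewrite rmorphB /= map_polyX map_polyC hornerXsubC.
Qed.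

Lemma dvd_prod f : f != 0 -> exists g cs, f * g = \prod_(c <- cs) (x - cst c).
Proof.
move=> /dvd_poly[g [q [/map_poly_x_split[k [cs [/cst_unit ku qE]]] fg]]].
exists (g * cst k^-1), cs.
by rewrite mulrA fg qE mulrC mulrA [cst _ * cst k]mulrC ku mul1r.
Qed.

(** Gaussian elimination on [vs]: for [q] in the ideal [I], finitely many elements
    of [I] generate all those that are congruent modulo [q] to a member of the
    [K]-span of [vs]. *)
Lemma ideal_fg_mod (I : {pred A}) q vs :
  submod_closed (I : {pred A^o}) -> q \in I ->
  exists gs, {subset gs <= I} /\
    forall f, f \in I -> (exists g h, in_span vs g /\ f = g + q * h) ->
      in_ideal_gen gs f.
Proof.
move=> [I0 Il] qI; elim: vs => [|v vs [gs [gsI IH]]].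
  exists [:: q]; split; first by move=> y; rewrite inE => /eqP ->.
  move=> f _ [g [h [-> ->]]]; exists h, 0; split=> //; ring.
have [|no] := pselect (exists k g h, [/\ k != 0, in_span vs g & cst k * v + g + q * h \in I]).
  move=> [k [g [h [k0 sg f0I]]]]; set f0 := _ + _ in f0I.
  exists (f0 :: gs); split; first by move=> y; rewrite inE => /predU1P[->//|/gsI].
  move=> f fI [_ [h' [[k' [g' [sg' ->]]] fE]]].
  exists (cst (k' / k)), (f - cst (k' / k) * f0); split; last by ring.
  apply: IH; first by rewrite addrC -mulNr; apply: (Il _ f0 f).
  exists (cst (- (k' / k)) * g + g'), (h' - cst (k' / k) * h).
  split; first exact: in_span_lin.
  have kE : cst k' = cst (k' / k) * cst k by rewrite -rmorphM divfK.
  by rewrite fE /f0 kE rmorphN; ring.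
exists gs; split=> // f fI [_ [h [[k [g [sg ->]]] fE]]]; apply: IH => //.
exists g, h; split=> //; rewrite fE.
have [->|k0] := eqVneq k 0; first by rewrite rmorph0; ring.
by case: no; exists k, g, h; rewrite -fE.
Qed.

Lemma A_noetherian : noetherian A.
Proof.
move=> I I_ideal; have [I0 Il] := I_ideal.
have [[f0 [f0I f00]]|no] := pselect (exists f, f \in I /\ f != 0); last first.
  apply: (@ideal_fg _ I [::]) => // f fI /=.
  by apply/eqP/negPn/negP => f0; apply: no; exists f.
have [g0 [cs qE]] := dvd_prod f00.
have qI : \prod_(c <- cs) (x - cst c) \in I.
  by rewrite -qE mulrC -[_ * _]addr0; apply: (Il g0 f0 0).
have [vs span] := span_mod_prod cs.
have [gs [gsI gen]] := ideal_fg_mod vs I_ideal qI.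
by apply: (ideal_fg I_ideal gsI) => f fI; apply: gen.
Qed.

(** The maximal ideal [(x - c, r (- c))]. *)
Definition cusp_pred (c : K) : {pred A} :=
  fun f => `[< exists g h, f = (x - cst c) * g + r (- c) * h >].

Lemma cusp_predP c f :
  reflect (exists g h, f = (x - cst c) * g + r (- c) * h) (f \in cusp_pred c).
Proof. exact: asboolP. Qed.

Lemma cusp_ideal c : idealr_closed (cusp_pred c).
Proof.
split.
- by apply/cusp_predP; exists 0, 0; rewrite !mulr0 addr0.
- by apply/cusp_predP => -[g [h e]]; apply: (@cusp_proper c g h).
- move=> a f f' /cusp_predP[g [h ->]] /cusp_predP[g' [h' ->]]; apply/cusp_predP.
  by exists (a * g + g'), (a * h + h'); ring.
Qed.

Lemma cusp_prime c : prime_idealr_closed (cusp_pred c).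
Proof.
move=> f f'; have [k [l [g ->]]] := cusp_decomp c f.
have [k' [l' [g' ->]]] := cusp_decomp c f'.
have inP a b b' : a = 0 -> cst a + cst b * r (- c) + (x - cst c) * b' \in cusp_pred c.
  by move=> ->; apply/cusp_predP; exists b', (cst b); rewrite rmorph0; ring.
move=> /cusp_predP[h [h' e]].
have [/inP -> //|k0] := eqVneq k 0; have [/inP -> //|k0'] := eqVneq k' 0.
  by rewrite orbT.
case: (@cusp_proper c
  (cst (k * k')^-1 * (h - g * (cst k' + cst l' * r (- c) + (x - cst c) * g') -
     g' * (cst k + cst l * r (- c))))
  (cst (k * k')^-1 * (h' - cst l * cst l' * r (- c) - cst k * cst l' - cst k' * cst l))).
have kk0 : k * k' != 0 by rewrite mulf_neq0.
rewrite -(cst_unit kk0) rmorphM.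
transitivity (cst (k * k')^-1 * (((x - cst c) * h + r (- c) * h') -
  (cst k + cst l * r (- c) + (x - cst c) * g) * (cst k' + cst l' * r (- c) + (x - cst c) * g')
  + cst k * cst k')); first by ring.
by rewrite -e; ring.
Qed.

Lemma zero_ideal : idealr_closed (pred1 (0 : A)).
Proof.
split; rewrite ?inE ?oner_neq0 //.
by move=> a f g; rewrite !inE => /eqP -> /eqP ->; rewrite mulr0 addr0.
Qed.

Lemma zero_prime : prime_idealr_closed (pred1 (0 : A)).
Proof. by move=> f g; rewrite !inE => /eqP/A_domain. Qed.

Lemma prime_contains_cusp (P : prime_idealr A) f : f \in P -> f != 0 ->
  exists c, x - cst c \in P /\ r (- c) \in P.
Proof.
move=> fP /dvd_prod[g [cs fg]].
have : \prod_(c <- cs) (x - cst c) \in P by rewrite -fg mulrC idealMr.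
elim: cs {fg} => [|c cs IH]; first by rewrite big_nil idealr1.
rewrite big_cons prime_idealrM => /orP[xP|/IH //].
exists c; split=> //.
have : r (- c) ^+ 2 \in P by rewrite r_cusp exprS mulrC idealMr.
by rewrite expr2 prime_idealrM orbb.
Qed.

(** A nonzero prime contains some [(x - c, r (- c))], whose residue field is
    [K]. *)
Lemma nonzero_prime_maximal (P Q : prime_idealr A) f :
  f \in P -> f != 0 -> {subset P <= Q} -> {subset Q <= P}.
Proof.
move=> fP f0 PQ; have [c [xP rP]] := prime_contains_cusp fP f0.
move=> g; have [k [l [h ->]]] := cusp_decomp c g.
have mP : cst l * r (- c) + (x - cst c) * h \in P.
  by apply: rpredD; [|rewrite mulrC]; apply: idealMr.
rewrite -addrA => gQ.
have : cst k \in Q by rewrite -(addrK (cst l * r (- c) + (x - cst c) * h) (cst k)) rpredB // PQ.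
have [->|k0] := eqVneq k 0; first by rewrite rmorph0 add0r.
by move=> kQ; have := idealMr (cst k^-1) kQ; rewrite mulrC cst_unit // idealr1.
Qed.

Lemma A_krull_dim : has_krull_dim A 1.
Proof.
split.
  pose P0 := prime_of_pred zero_ideal zero_prime.
  pose P1 := prime_of_pred (cusp_ideal 0) (@cusp_prime 0).
  exists (fun i => if i == ord0 then P0 else P1) => -[[|[|//]] iP] [[|[|//]] jP] //= _.
  split; first by move=> f; rewrite inE => /eqP ->; apply: (idealr0 P1).
  move=> /(_ (x - cst 0)) sub; have /eqP := x_sub_neq0 0; apply.
  apply/eqP/sub/cusp_predP; exists 1, 0; ring.
move=> n P chain; rewrite leqNgt; apply/negP => n2.
have n1 := ltnW n2.
pose i0 : 'I_n.+1 := ord0.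
pose i1 : 'I_n.+1 := Ordinal (n1 : (1 < n.+1)%N).
pose i2 : 'I_n.+1 := Ordinal (n2 : (2 < n.+1)%N).
have [_ P10] := chain i0 i1 isT; have [P12 P21] := chain i1 i2 isT.
have [f fP f0] : exists2 f, f \in P i1 & f != 0.
  have [//|no] := pselect (exists2 f, f \in P i1 & f != 0).
  case: P10 => f fP; have [->|f0] := eqVneq f 0; first exact: idealr0.
  by case: no; exists f.
exact: P21 (nonzero_prime_maximal fP f0 P12).
Qed.

(** At most one [x + cst a] lies in [P]. If [x - cst c] is the one, or if there is
    none and [c] is arbitrary, every [r a] other than
    [r (- c)] is a unit of the localization, and [r a = (r a)^p / (r a)^(p-1)] where
    [(r a)^(p-1)] is a polynomial in [x]; the localization is therefore generated
    by [x] and [r (- c)] over its [p]-th powers. *)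
Lemma localization_F_finite p (charAp : p \in [pchar A]) (P : prime_idealr A) :
  odd p ->
  F_finite (pchar_localization P charAp).
Proof.
move=> p_odd; have p0 := prime_gt0 (pcharf_prime charAp).
have [c cP] : exists c, forall a, c + a != 0 -> x + cst a \notin P.
  have [[a0 a0P]|no] := pselect (exists a, x + cst a \in P); last first.
    by exists 0 => a _; apply/negP => aP; apply: no; exists a.
  exists (- a0) => a a0a; apply/negP => aP.
  have : cst (- a0 + a) \in P.
    rewrite rmorphD rmorphN (_ : _ + _ = (x + cst a) - (x + cst a0)); last by ring.
    by rewrite rpredB.
  by move=> /(idealMr (cst (- a0 + a)^-1)); rewrite mulrC cst_unit // idealr1.
pose L : {rmorphism A -> localization P} := to_loc P.
pose W := frob_span p (L x) (L (r (- c))).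
have Winv := frob_span_inv (pchar_localization P charAp).
have Wcst k : W (L (cst k)).
  have [k' /= kE] : exists k', k' ^+ p = k.
    have /closed_rootP[k' rk] : size ('X^p - k%:P) != 1.
      by rewrite size_XnsubC // eqSS -lt0n.
    exists k'; apply/eqP; rewrite -subr_eq0.
    by move: rk; rewrite /root hornerD hornerN hornerXn hornerC.
  by rewrite -kE !rmorphXn; apply: frob_span_pow.
have Wr a : W (L (r a)).
  have [ca0|ca0] := eqVneq (c + a) 0.
    have -> : a = - c by apply/eqP; rewrite -addr_eq0 addrC ca0.
    exact: frob_span_v.
  have rP : r a \notin P.
    apply: contra (cP a ca0) => raP.
    have : (x + cst a) ^+ 3 \in P by rewrite -r_sqr expr2 idealMr.
    by rewrite exprS expr2 !prime_idealrM orbb orbb.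
  have [w rw] := loc_inv rP.
  have pE : p = (p./2 * 2).+1 by rewrite -[in LHS](odd_double_half p) p_odd muln2.
  have -> : L (r a) = L (r a) ^+ p * w ^+ (p./2 * 2).
    by rewrite [in X in _ ^+ X]pE exprS -mulrA -exprMn rw expr1n mulr1.
  apply: frob_span_mul; first exact: frob_span_pow.
  apply: (Winv _ _ (L (r a ^+ 2 ^+ p./2))).
    rewrite r_sqr !rmorphXn rmorphD; do 2 apply: frob_span_exp.
    by apply: frob_span_add; [apply: frob_span_u | apply: Wcst].
  by rewrite -exprM mulnC rmorphXn -exprMn rw expr1n.
have WA f : W (L f).
  elim/A_ind: f => [k||a b w b0 wE|f g Wf Wg|f g Wf Wg].
  - exact: Wcst.
  - exact: frob_span_u.
  - apply: (Winv _ _ (L (r a + cst (s (b ^+ 3))))).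
      by rewrite rmorphD; apply: frob_span_add; [apply: Wr | apply: Wcst].
    by rewrite -(rmorphM L) wE rmorph1.
  - by rewrite rmorphD; apply: frob_span_add.
  - by rewrite rmorphM; apply: frob_span_mul.
apply: (@F_finite_frob_span _ _ _ (L x) (L (r (- c)))) => y.
have [a [t [tP yE]]] := loc_frac y; have [w tw] := loc_inv tP.
have -> : y = L a * w by rewrite -[y]mulr1 -tw mulrA; congr (_ * w).
by apply: frob_span_mul; [apply: WA | apply: Winv tw; apply: WA].
Qed.
End CuspidalRing.

(** * Generated subalgebras *)

Section Subalgebra.
Variables (K L : comNzRingType) (f : {rmorphism K -> L}) (G : L -> Prop).
Local Notation A := (subalg f G).

(** The inclusion of the subalgebra. *)
Definition incl : {rmorphism A -> L} := \val.

Lemma incl_inj : injective incl. Proof. exact: val_inj. Qed.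

Definition mk_subalg (y : L) (hy : in_subalg f G y) : A :=
  Subalg (introT (subalgP _ _ _) hy).

Lemma in_subalg_incl (y : A) : in_subalg f G (incl y).
Proof. exact/subalgP/valP. Qed.

Definition subalg_scalar (k : K) : A := mk_subalg (In_subalg_scalar f G k).

Lemma incl_scalar k : incl (subalg_scalar k) = f k. Proof. by []. Qed.

Lemma subalg_scalar_is_zmod_morphism : zmod_morphism subalg_scalar.
Proof. by move=> k l; apply: incl_inj; rewrite rmorphB !incl_scalar rmorphB. Qed.

Lemma subalg_scalar_is_monoid_morphism : monoid_morphism subalg_scalar.
Proof.
split=> [|k l]; apply: incl_inj; first by rewrite incl_scalar !rmorph1.
by rewrite rmorphM !incl_scalar rmorphM.
Qed.

HB.instance Definition _ := GRing.isZmodMorphism.Build K A subalg_scalar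
  subalg_scalar_is_zmod_morphism.
HB.instance Definition _ := GRing.isMonoidMorphism.Build K A subalg_scalar
  subalg_scalar_is_monoid_morphism.

(** [in_subalg] as an induction principle on the elements of the subalgebra. *)
Lemma subalg_ind_incl (Q : A -> Prop) :
  (forall k, Q (subalg_scalar k)) ->
  (forall y : A, G (incl y) -> Q y) ->
  (forall y z, Q y -> Q z -> Q (y + z)) ->
  (forall y z, Q y -> Q z -> Q (y * z)) ->
  forall y, Q y.
Proof.
move=> Qk QG QD QM y; have := in_subalg_incl y; move yv: (incl y) => v vA.
elim: vA y yv => {v} [k|v Gv|v w sv IHv sw IHw|v w sv IHv sw IHw] y yv.
- by have -> : y = subalg_scalar k by apply: incl_inj.
- by apply: QG; rewrite yv.
- have -> : y = mk_subalg sv + mk_subalg sw by apply: incl_inj; rewrite rmorphD.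
  by apply: QD; [apply: IHv | apply: IHw].
- have -> : y = mk_subalg sv * mk_subalg sw by apply: incl_inj; rewrite rmorphM.
  by apply: QM; [apply: IHv | apply: IHw].
Qed.
End Subalgebra.

Theorem theorem8 (p : nat) (K Omega : closedFieldType)
    (iota : {rmorphism {fraction {poly K}} -> Omega})
    (r : K -> Omega) (s : K -> K)
    (p_prime : prime p) (p_odd : odd p) (charKp : p \in [pchar K])
    (Omega_algebraic : forall x : Omega, algebraicOver iota x)
    (r_sqrt : forall a : K, r a ^+ 2 = iota (tofrac (('X + a%:P) ^+ 3)))
    (s_sqrt : forall c : K, c != 0 -> s c ^+ 2 = c) :
  let A := ringA iota r s in
  let charAp : p \in [pchar A] := pchar_subalg _ _ charKp in
  [/\ GRing.integral_domain_axiom A,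
      noetherian A,
      has_krull_dim A 1,
      ~ F_finite charAp
    & forall P : prime_idealr A, F_finite (pchar_localization P charAp)].
Proof.
move=> A charAp.
have p_gt2 : (2 < p)%N.
  by rewrite ltn_neqAle prime_gt1 // andbT; apply: contraTneq p_odd => <-.
have two_neq0 : 2 != 0 :> K by rewrite -(dvdn_pcharf charKp) gtnNdvd.
pose G := genA iota r s; pose e := const_emb iota.
pose cst : {rmorphism K -> A} := @subalg_scalar _ _ e G.
have den0 := denom_neq0 two_neq0 r_sqrt s_sqrt 0.
have xG : in_subalg e G (iota (tofrac 'X)) by apply: In_subalg_gen; left.
pose x : A := mk_subalg xG.
pose i : {rmorphism A -> Omega} := @incl _ _ e G.
have i_inj : injective i by apply: incl_inj.
have wG a b : b != 0 -> in_subalg e G (r a + e (s (b ^+ 3)))^-1.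
  by move=> b0; apply: In_subalg_gen; right; exists a, b.
have i_cst k : i (cst k) = e k by [].
have i_x a : i (x + cst a) = iota (tofrac ('X + a%:P)) by rewrite !rmorphD.
have rG a : in_subalg e G (r a).
  have b0 : (1 : K) != 0 by apply: oner_neq0.
  (* r a - k = ((X + a)^3 - k^2) / (r a + k) for a denominator r a + k *)
  pose w : A := mk_subalg (wG a 1 b0); pose k := s (1 ^+ 3).
  suff -> : r a = i (cst k + ((x + cst a) ^+ 3 - cst k ^+ 2) * w).
    exact: in_subalg_incl.
  have i_w : i w = (r a + e k)^-1 by [].
  have r_cube : i (x + cst a) ^+ 3 = r a ^+ 2 by rewrite i_x r_sqrt !rmorphXn.
  rewrite rmorphD rmorphM rmorphB !(rmorphXn i) r_cube i_cst i_w.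
  apply: (mulIf (den0 a 1 b0)); rewrite mulrDl mulfVK ?den0 // -/e -/k.
  by ring.
pose rA a : A := mk_subalg (rG a).
have i_r a : i (rA a) = r a by [].
have i_den a b : i (rA a + cst (s (b ^+ 3))) = r a + e (s (b ^+ 3)).
  by rewrite rmorphD i_r i_cst.
have A_domain : GRing.integral_domain_axiom A.
  move=> y z yz; have /eqP : i y * i z = 0 by rewrite -rmorphM yz rmorph0.
  rewrite mulf_eq0 => /orP[] /eqP v0; apply/orP; [left|right]; apply/eqP/i_inj.
    by rewrite v0 rmorph0.
  by rewrite v0 rmorph0.
have r_sqr a : rA a ^+ 2 = (x + cst a) ^+ 3.
  by apply: i_inj; rewrite !(rmorphXn i) i_x i_r r_sqrt !rmorphXn.
have denom_inv a b : b != 0 -> exists w, (rA a + cst (s (b ^+ 3))) * w = 1.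
  move=> b0; exists (mk_subalg (wG a b b0)); apply: i_inj.
  by rewrite rmorphM rmorph1 i_den mulfV // den0.
have A_ind (Q : A -> Prop) : (forall k, Q (cst k)) -> Q x ->
    (forall a b w, b != 0 -> (rA a + cst (s (b ^+ 3))) * w = 1 -> Q w) ->
    (forall f g, Q f -> Q g -> Q (f + g)) ->
    (forall f g, Q f -> Q g -> Q (f * g)) -> forall f, Q f.
  move=> Qk Qx Qw QD QM; apply: subalg_ind_incl => // y [yx|[a [b [b0 yw]]]].
    by have -> : y = x by apply: i_inj.
  apply: (Qw a b) => //; apply: i_inj.
  by rewrite rmorphM rmorph1 i_den [i y]yw mulfV // den0.
have dvd_poly f : f != 0 ->
    exists g (q : {poly K}), q != 0 /\ f * g = (map_poly cst q).[x].
  move=> f0; have [P P0 Pf] := Omega_algebraic (i f).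
  have [d [Q [d0 dP]]] := frac_polyE P.
  pose ev : {rmorphism {poly K} -> A} := horner_morph (fun k => mulrC x (cst k)).
  have i_ev q : i (ev q) = iota (tofrac q).
    elim/poly_ind: q => [|q k IH]; first by rewrite !rmorph0.
    rewrite !(rmorphD, rmorphM) IH; congr (_ * _ + _).
      by rewrite /ev /= horner_morphX.
    by rewrite /ev /= horner_morphC.
  apply: (root_dvd_coef (ev := ev) (Q := Q)) => //.
    apply: contraNneq P0 => Q0; move: dP; rewrite Q0 map_poly0 => /eqP.
    by rewrite scaler_eq0 tofrac_eq0 (negPf d0).
  apply: i_inj; rewrite -horner_map -map_poly_comp rmorph0.
  have -> : map_poly (i \o ev) Q = map_poly iota (tofrac d *: P).
    by rewrite dP -map_poly_comp; apply: eq_map_poly => q; apply: i_ev.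
  by rewrite map_polyZ hornerZ (rootP Pf) mulr0.
have x_sub c f : (x - cst c) * f <> 1.
  move=> /(congr1 i); rewrite rmorphM rmorphB rmorph1 i_cst.
  have -> : i x - e c = iota (tofrac ('X - c%:P)) by rewrite !rmorphB.
  exact: (XsubC_nonunit two_neq0 r_sqrt s_sqrt (in_subalg_incl f)).
split=> //.
- exact: A_noetherian two_neq0 s_sqrt r_sqr denom_inv A_ind dvd_poly.
- exact: A_krull_dim two_neq0 s_sqrt A_domain r_sqr denom_inv A_ind dvd_poly x_sub.
- exact: not_F_finite two_neq0 s_sqrt A_domain r_sqr denom_inv A_ind x_sub _ _ p_gt2.
- by move=> P; apply: (localization_F_finite r_sqr A_ind).
Qed.
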